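(* Let $q\geq 3$ be an integer. For every real number $y$, the Rosen continued fraction produced by the nearest-integer algorithm applied to $y$ is a geodesic Rosen continued fraction. (It is finite when $y$ is a vertex of the Farey graph $\mathcal{F}_q$, and infinite otherwise.)
   Context: Let $\lambda_q=2\cos(\pi/q)$ and let $G_q$ be the group of Möbius transformations generated by $\sigma(z)=-1/z$ and $\tau(z)=z+\lambda_q$. Write $\mathbb{R}_\infty=\mathbb{R}\cup\{\infty\}$. The Farey graph $\mathcal{F}_q$ has vertex set the orbit $G_q(\infty)\subset\mathbb{R}_\infty$, and two vertices $u,v$ are adjacent iff $\{u,v\}=\{g(0),g(\infty)\}$ for some $g\in G_q$. For integers $b_1,\dots,b_n$ put $s_i(z)=b_i\lambda_q-1/z$. The (finite) Rosen continued fraction $[b_1,\dots,b_n]_q$ (formally $b_1\lambda_q-\cfrac{1}{b_2\lambda_q-\cfrac{1}{\ddots\, -\cfrac{1}{b_n\lambda_q}}}$) has value $s_1\circ\dots\circ s_n(\infty)\in\mathbb{R}_\infty$ and convergents $s_1\circ\dots\circ s_m(\infty)$, $m=1,\dots,n$; it is an expansion of its value. A finite Rosen continued fraction $[b_1,\dots,b_n]_q$ with value $y$ is geodesic if every finite Rosen continued fraction with value $y$ has at least $n$ terms. An infinite Rosen continued fraction $[b_1,b_2,\dots]_q$ (an infinite integer sequence) is geodesic if $[b_1,\dots,b_m]_q$ is geodesic for every $m\geq1$. Nearest-integer algorithm: for real $x$, let $\Vert x\Vert_q$ be the integer multiple of $\lambda_q$ nearest to $x$, taking the lesser one when $x$ is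 exactly halfway between two. Given real $y$, set $b_1\lambda_q=\Vert y\Vert_q$; having defined $b_1,\dots,b_k$ (and $s_1,\dots,s_k$), if $w_k=s_k^{-1}\circ\dots\circ s_1^{-1}(y)\neq\infty$ set $b_{k+1}\lambda_q=\Vert w_k\Vert_q$, and otherwise stop. The output is the (finite or infinite) sequence $b_1,b_2,\dots$, giving the Rosen continued fraction $[b_1,b_2,\dots]_q$. *)

(* Defs.v *)
From mathcomp Require Import all_boot all_order all_algebra.
From mathcomp Require Import all_classical all_reals all_analysis.
From mathcomp Require Import ring lra.
Set Implicit Arguments.
Unset Strict Implicit.
Unset Printing Implicit Defensive.
Import Order.TTheory GRing.Theory Num.Theory.
Local Open Scope ring_scope.

Definition lambda (R : realType) (q : nat) : R := 2 * cos (pi / q%:R).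

(* The extended real line: [Some x] is the real point [x], [None] is infinity.
   A real Moebius transformation is determined by its action on this set. *)
Definition Rinf (R : realType) : Type := option R.

Definition translate (R : realType) (c : R) (z : Rinf R) : Rinf R :=
  if z is Some x then Some (x + c) else None.

Definition sigma (R : realType) (z : Rinf R) : Rinf R :=
  match z with
  | Some x => if x == 0 then None else Some (- x^-1)
  | None => Some 0
  end.

Definition tau (R : realType) (q : nat) : Rinf R -> Rinf R :=
  translate (lambda R q).

Inductive in_G (R : realType) (q : nat) : (Rinf R -> Rinf R) -> Prop :=
| in_G_id : in_G q id
| in_G_sigma : in_G q (@sigma R)
| in_G_tau : in_G q (@tau R q)
| in_G_comp f g : in_G q f -> in_G q g -> in_G q (f \o g)
| in_G_inv f g : in_G q f -> cancel f g -> cancel g f -> in_G q g.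

Definition farey_vertex (R : realType) (q : nat) (v : Rinf R) : Prop :=
  exists2 g, in_G q g & v = g None.

Definition rosen_s (R : realType) (q : nat) (b : int) (z : Rinf R) : Rinf R :=
  translate (b%:~R * lambda R q) (sigma z).

Definition rosen_s_inv (R : realType) (q : nat) (b : int) (z : Rinf R) :
    Rinf R :=
  sigma (translate (- (b%:~R * lambda R q)) z).

Lemma translateK (R : realType) (c : R) :
  cancel (translate c) (translate (- c)).
Proof. by case=> //= x; rewrite addrK. Qed.

Lemma sigmaK (R : realType) : involutive (@sigma R).
Proof.
case=> [x|] /=; last by rewrite eqxx.
have [->//|x0] := eqVneq x 0.
by rewrite /= oppr_eq0 invr_eq0 (negbTE x0) invrN invrK opprK.
Qed.

Lemma rosen_sK (R : realType) (q : nat) (b : int) :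
  cancel (@rosen_s R q b) (rosen_s_inv q b).
Proof. by move=> z; rewrite /rosen_s_inv translateK sigmaK. Qed.

Lemma rosen_s_invK (R : realType) (q : nat) (b : int) :
  cancel (@rosen_s_inv R q b) (rosen_s q b).
Proof.
move=> z; rewrite /rosen_s sigmaK.
by rewrite -[X in translate X (translate _ _)]opprK translateK.
Qed.

(* The empty sequence is not a continued fraction; see [geodesic_finite]. *)
Definition rosen_value (R : realType) (q : nat) (s : seq int) : Rinf R :=
  foldr (@rosen_s R q) None s.

Variant rosen_cf : Type :=
| FiniteCF of seq int
| InfiniteCF of (nat -> int).

Definition is_finite_cf (c : rosen_cf) : Prop :=
  if c is FiniteCF _ then True else False.

Definition geodesic_finite (R : realType) (q : nat) (s : seq int) : Prop :=
  (0 < size s)%N /\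
  forall t : seq int, (0 < size t)%N ->
    rosen_value R q t = rosen_value R q s -> (size s <= size t)%N.

Definition geodesic (R : realType) (q : nat) (c : rosen_cf) : Prop :=
  match c with
  | FiniteCF s => geodesic_finite R q s
  | InfiniteCF b =>
      forall m : nat, (1 <= m)%N -> geodesic_finite R q (mkseq b m)
  end.

Definition is_nearest (R : realType) (q : nat) (x : R) (b : int) : Prop :=
  (forall c : int,
     `|x - b%:~R * lambda R q| <= `|x - c%:~R * lambda R q|) /\
  (forall c : int,
     `|x - c%:~R * lambda R q| = `|x - b%:~R * lambda R q| ->
     b%:~R * lambda R q <= c%:~R * lambda R q).

(* The default value 0 is never used when [3 <= q]: see [nearestP]. *)
Definition nearest (R : realType) (q : nat) (x : R) : int :=
  xget 0 [set b : int | is_nearest q x b]%classic.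

Lemma lambda_gt0 (R : realType) (q : nat) : (3 <= q)%N -> 0 < lambda R q.
Proof.
move=> q3; rewrite /lambda mulr_gt0 // cos_gt0_pihalf //.
have pi0 := pi_gt0 R.
have q0 : 0 < q%:R :> R by rewrite ltr0n; apply: leq_trans q3.
apply/andP; split.
  by apply: (@lt_trans _ _ 0); [lra | exact: divr_gt0].
by rewrite ltr_pM2l // ltf_pV2 ?posrE // ltr_nat.
Qed.

Lemma nearestP (R : realType) (q : nat) (x : R) : (3 <= q)%N ->
  is_nearest q x (nearest q x) /\
  forall b, is_nearest q x b -> b = nearest q x.
Proof.
move=> q3; have l0 := lambda_gt0 R q3.
have ex : is_nearest q x (nearest q x).
  apply: (@xgetPex _ 0 [set b : int | is_nearest q x b]%classic).
  set l := lambda R q in l0 *.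
  set b := Num.ceil (x / l - 2^-1); exists b.
  have [lb ub] : x / l - 2^-1 <= b%:~R /\ b%:~R - 1 < x / l - 2^-1.
    split; first exact: ceil_ge.
    by have := ceilB1_lt (x / l - 2^-1); rewrite -/b intrB.
  have xE : x = x / l * l by rewrite divfK // gt_eqF.
  set u := x / l in lb ub xE.
  rewrite /= /is_nearest -/l.
  have dist c : `|x - c%:~R * l| = `|u - c%:~R| * l.
    by rewrite {1}xE -mulrBl normrM (gtr0_norm l0).
  have far c : (c <= b - 1 -> `|u - b%:~R| < `|u - c%:~R|) /\
               (b <= c -> `|u - b%:~R| <= `|u - c%:~R|).
    split=> cb.
      have : c%:~R <= b%:~R - 1 :> R.
        by have := cb; rewrite -(ler_int R) intrB.
      move=> h; rewrite (ger0_norm (_ : 0 <= u - c%:~R)); last by lra.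
      by rewrite ltr_norml; apply/andP; split; lra.
    have [->//|/eqP cNb] := eqVneq c b.
    have h : b%:~R + 1 <= c%:~R :> R.
      have : (b + 1 <= c)%R by rewrite lezD1 lt_neqAle cb eq_sym; apply/andP; split=> //; apply/eqP.
      by rewrite -(ler_int R) intrD.
    rewrite (ler0_norm (_ : u - c%:~R <= 0)); last by lra.
    by rewrite ler_norml; apply/andP; split; lra.
  split=> c; rewrite !dist.
    rewrite ler_pM2r //; case: (lerP b c) => [/(proj2 (far c))//|cb].
    by apply/ltW/(proj1 (far c)); rewrite lerBrDr lezD1.
  move=> /(mulIf (lt0r_neq0 l0)) E; rewrite ler_pM2r // ler_int leNgt.
  apply/negP => cb; have := proj1 (far c).
  by rewrite lerBrDr lezD1 E ltxx => /(_ cb).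
split=> // b [b1 b2]; case: ex; set n := nearest q x => n1 n2.
have E : `|x - b%:~R * lambda R q| = `|x - n%:~R * lambda R q|.
  by apply/eqP; rewrite eq_le b1 n1.
have := b2 n (esym E); have := n2 b E; rewrite !ler_pM2r // !ler_int => h k.
by apply/eqP; rewrite eq_le h k.
Qed.

(* [ni_rem q y k] is the point s_k^{-1} o ... o s_1^{-1} (y); once it is
   infinity the algorithm has stopped, and it is kept at infinity. *)
Fixpoint ni_rem (R : realType) (q : nat) (y : R) (k : nat) : Rinf R :=
  match k with
  | 0%N => Some y
  | k'.+1 =>
      if ni_rem q y k' is Some x then rosen_s_inv q (nearest q x) (Some x)
      else None
  end.

(* Indices start at 0, so this is the coefficient b_{k+1}; it is meaningful
   only as long as [ni_rem q y k] is finite. *)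
Definition ni_coef (R : realType) (q : nat) (y : R) (k : nat) : int :=
  if ni_rem q y k is Some x then nearest q x else 0.

Definition nearest_integer_cf (R : realType) (q : nat) (y : R) : rosen_cf :=
  match pselect (exists n : nat, ni_rem q y n == None) with
  | left stops => FiniteCF (mkseq (ni_coef q y) (ex_minn stops))
  | right _ => InfiniteCF (ni_coef q y)
  end.

(* Main.v *)
(* Write [x = sin (phi - theta) / sin phi] with [theta = pi / q].  The rotation
   [z |-> lambda - 1/z] then becomes [phi |-> phi - theta], with [phi] taken
   modulo [pi].  Let [f z] be the length of a nearest-integer expansion of [z];
   as [f] is invariant under [z |-> -z] and [z |-> z + lambda], ties do not
   matter.  That no expansion is shorter than a nearest-integer one amounts to
   [f (-1/z) <= f z + 1].  This is clear when [z] or [-1/z] has absolute value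
   at most [lambda / 2].  Otherwise, following the two expansions around a
   common face until they leave it replaces the pair [z], [-1/z] by a smaller
   one, exactly when [q] is even, and exchanging its members and shifting by
   one when [q] is odd; one therefore proves the sharper statement that
   [f x - f (-1/x)] is [0] or [1] for [0 <= x <= 1].
   A prefix of the expansion of [y] is again a nearest-integer expansion of its
   value: if a remainder of [y] has absolute value at least [2 / lambda], then
   so has the corresponding remainder of the prefix, for otherwise going round
   the face would give the two remainders different coefficients. *)
Require Import Defs.
From mathcomp Require Import all_boot all_order all_algebra.
From mathcomp Require Import all_classical all_reals all_analysis.
From mathcomp Require Import ring lra.
From mathcomp Require Import zify.

Set Implicit Arguments.
Unset Strict Implicit.
Unset Printing Implicit Defensive.
Import Order.TTheory GRing.Theory Num.Theory.
Local Open Scope ring_scope.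

Section Rosen.
Variables (R : realType) (q : nat).
Hypothesis hq : (3 <= q)%N.

Local Notation l := (lambda R q).
Local Notation theta := (pi / q%:R : R).
Local Notation sigma := (@sigma R).
Implicit Types (x y phi psi : R) (z u w : Rinf R) (s t : seq int).

(** * The angle $\pi/q$ and the angle coordinate *)

Lemma mulq_theta : q%:R * theta = pi.
Proof. by rewrite mulrCA divff ?mulr1 // pnatr_eq0 -lt0n; apply: leq_trans hq. Qed.

Lemma theta_gt0 : 0 < theta.
Proof. by rewrite divr_gt0 ?pi_gt0 // ltr0n; apply: leq_trans hq. Qed.

Lemma mul3_theta_le_pi : 3 * theta <= pi.
Proof. by rewrite -[leRHS]mulq_theta ler_pM2r ?theta_gt0 // ler_nat. Qed.

Lemma lambda_lt2 : l < 2.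
Proof.
have th0 := theta_gt0; have th3 := mul3_theta_le_pi.
rewrite /lambda gtr_pMr // -[ltRHS](@cos0 R) ltr_cos // in_itv /=;
  apply/andP; split; lra.
Qed.

Definition angle_val phi : R := sin (phi - theta) / sin phi.

Definition angle_pt phi : Rinf R :=
  if sin phi == 0 then None else Some (angle_val phi).

Lemma sin_neq0 phi : 0 < phi < pi -> sin phi != 0.
Proof. by move=> h; rewrite gt_eqF // sin_gt0_pi. Qed.

Lemma angle_ptE phi : 0 < phi < pi -> angle_pt phi = Some (angle_val phi).
Proof. by rewrite /angle_pt => /sin_neq0/negbTE ->. Qed.

Lemma angle_pt0 : angle_pt 0 = None.
Proof. by rewrite /angle_pt sin0 eqxx. Qed.

Lemma angle_ptDpi phi : angle_pt (phi + pi) = angle_pt phi.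
Proof.
rewrite /angle_pt /angle_val addrAC !sinDpi oppr_eq0.
by rewrite invrN mulrNN.
Qed.

Lemma angle_ptBpi phi : angle_pt (phi - pi) = angle_pt phi.
Proof. by rewrite -[in RHS](subrK pi phi) angle_ptDpi. Qed.

(* [translate l \o sigma] is a rotation by one step of the face with vertices
   [angle_pt (k * theta)], and [angle_pt] linearises it. *)
Lemma angle_ptB phi : angle_pt (phi - theta) = translate l (sigma (angle_pt phi)).
Proof.
have e : sin (phi - theta - theta) = l * sin (phi - theta) - sin phi.
  rewrite -[X in _ - sin X](subrK theta phi); move: (phi - theta) => p.
  by rewrite sinB sinD /lambda; ring.
rewrite /angle_pt /angle_val.
have [p0|pN0] := eqVneq (sin phi) 0.
  have s0 : sin (phi - theta) != 0.
    have : cos phi != 0 by rewrite -normr_gt0 sin0cos1.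
    rewrite sinB p0 mul0r sub0r oppr_eq0 mulf_eq0 negb_or => -> /=.
    rewrite sin_neq0 // theta_gt0 /=.
    by have := mul3_theta_le_pi; have := theta_gt0; lra.
  by rewrite (negbTE s0) e p0 subr0 mulfK //= add0r.
rewrite /=; have [s0|sN0] := eqVneq (sin (phi - theta)) 0.
  by rewrite s0 mul0r eqxx.
rewrite mulf_eq0 invr_eq0 (negbTE sN0) (negbTE pN0) /= e.
by congr Some; field; rewrite sN0 pN0.
Qed.

Definition oppi z : Rinf R := if z is Some x then Some (- x) else None.

(** As $\sin(\phi+\theta)+\sin(\phi-\theta)=\lambda\sin\phi$, changing the sign of the angle is the
    reflection of the face that fixes infinity. *)
Lemma angle_ptN phi : angle_pt (- phi) = translate l (oppi (angle_pt phi)).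
Proof.
rewrite /angle_pt /angle_val sinN oppr_eq0; case: eqP => //= /eqP p0.
congr Some; rewrite -opprD sinN (sinD phi theta) (sinB phi theta) /lambda.
by field.
Qed.

Lemma angle_val_sub phi psi : 0 < phi < pi -> 0 < psi < pi ->
  angle_val phi - angle_val psi
    = sin theta * sin (phi - psi) / (sin phi * sin psi).
Proof.
move=> /sin_neq0 h /sin_neq0 k; rewrite /angle_val !sinB.
by field; rewrite h k.
Qed.

Lemma sin_theta_gt0 : 0 < sin theta.
Proof.
apply: sin_gt0_pi; rewrite theta_gt0 /=.
by have := mul3_theta_le_pi; have := theta_gt0; lra.
Qed.

Lemma ltr_angle_val phi psi : 0 < phi < pi -> 0 < psi < pi ->
  (angle_val phi < angle_val psi) = (phi < psi).
Proof.
have lt a b : 0 < a < pi -> 0 < b < pi -> a < b -> angle_val a < angle_val b.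
  move=> ha hb ab; rewrite -subr_gt0 angle_val_sub // divr_gt0 ?mulr_gt0 //.
  - exact: sin_theta_gt0.
  - by apply: sin_gt0_pi; lra.
  - exact: sin_gt0_pi.
  - exact: sin_gt0_pi.
move=> hp hs; case: (ltgtP phi psi) => [|h|->]; [exact: lt | | by rewrite ltxx].
by apply/negbTE; rewrite -leNgt ltW // lt.
Qed.

Lemma ler_angle_val phi psi : 0 < phi < pi -> 0 < psi < pi ->
  (angle_val phi <= angle_val psi) = (phi <= psi).
Proof. by move=> h k; rewrite !leNgt ltr_angle_val. Qed.

(** The evaluations from here on turn thresholds into angles: beyond [l / 2] the coefficient 0 is no
    longer nearest, 1 is where [sigma] preserves the modulus, and [2 / l] is the inverse of
    [l / 2]. *)
Lemma angle_val_theta : angle_val theta = 0.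
Proof. by rewrite /angle_val subrr sin0 mul0r. Qed.

Lemma angle_val_pihalf : angle_val (pi / 2) = l / 2.
Proof.
rewrite /angle_val sin_pihalf divr1 sinB sin_pihalf cos_pihalf /lambda.
by rewrite mul1r mul0r subr0; field.
Qed.

Lemma angle_val_mid : angle_val ((pi + theta) / 2) = 1.
Proof.
have th0 := theta_gt0; have th3 := mul3_theta_le_pi.
have -> : (pi + theta) / 2 = theta / 2 + pi / 2 by lra.
rewrite /angle_val addrAC !sinDpihalf.
have -> : theta / 2 - theta = - (theta / 2) by lra.
rewrite cosN divff // gt_eqF // cos_gt0_pihalf //; lra.
Qed.

Lemma angle_val_pihalfD : angle_val (pi / 2 + theta) = 2 / l.
Proof.
rewrite /angle_val addrK sin_pihalf [pi / 2 + _]addrC sinDpihalf /lambda.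
by rewrite invfM mulrA divff ?pnatr_eq0 // mul1r.
Qed.

Lemma sin_pi_sub x : sin (pi - x) = sin x.
Proof. by rewrite sinB sinpi cospi mul0r mulN1r sub0r opprK. Qed.

Lemma angle_valBpi : angle_val (pi - theta) = l.
Proof.
have := sin_theta_gt0; rewrite /angle_val -addrA -opprD !sin_pi_sub sinD /lambda => s0.
by field; rewrite gt_eqF.
Qed.

Lemma angle_pt_surj x : exists2 phi, 0 < phi < pi & angle_pt phi = Some x.
Proof.
(* Solves $x=\cos\theta-\sin\theta\cot\phi$ with $\phi=a+\pi/2$. *)
pose a := atan ((x - cos theta) / sin theta).
have [a1 a2] : - (pi / 2) < a /\ a < pi / 2.
  by split; [exact: atan_gtNpi2 | exact: atan_ltpi2].
have ca : cos a != 0 by rewrite gt_eqF // cos_gt0_pihalf // a1.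
have ta : sin a = (x - cos theta) / sin theta * cos a.
  by rewrite -[X in X * _]atanK -/a /tan divfK.
have h : 0 < a + pi / 2 < pi by lra.
exists (a + pi / 2) => //; rewrite angle_ptE // /angle_val; congr Some.
rewrite sinB sinDpihalf cosDpihalf ta.
by field; rewrite ca gt_eqF // sin_theta_gt0.
Qed.

(** * Lengths of nearest-integer expansions *)

(* The integer [b] is a multiple of [l] nearest to [x], with no rule for ties. *)
Definition near x (b : int) := `|x - b%:~R * l| <= l / 2.

(* [wlen n z]: [z] has an [n]-term expansion in which every coefficient is a
   nearest one, ties being broken arbitrarily. *)
Fixpoint wlen n z : Prop :=
  if n is n'.+1 then
    exists x b, [/\ z = Some x, near x b & wlen n' (sigma (Some (x - b%:~R * l)))]
  else z = None.

Lemma near_exists x : exists b, near x b.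
Proof.
have l0 := lambda_gt0 R hq.
exists (Num.floor (x / l + 2^-1)); rewrite /near.
have := floor_itv (x / l + 2^-1); set b := Num.floor _; rewrite intrD => /andP[h1 h2].
have e : x = x / l * l by rewrite divfK // gt_eqF.
rewrite {1}e -mulrBl normrM (gtr0_norm l0) mulrC ler_pM2l // ler_norml.
by apply/andP; split; lra.
Qed.

Lemma near_nearest x : near x (nearest q x).
Proof.
have [[h _] _] := nearestP x hq; have [b xb] := near_exists x.
exact: le_trans (h b) xb.
Qed.

Lemma near_ge1 x b : near x b -> l / 2 < x -> 1 <= b.
Proof.
have l0 := lambda_gt0 R hq; rewrite /near ler_norml => /andP[h1 h2] h3.
have : 0 < b%:~R * l by lra.
by rewrite pmulr_lgt0 // ltr0z.
Qed.

Lemma near_le x b (k : int) : near x b -> x < k%:~R * l + l / 2 -> b <= k.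
Proof.
have l0 := lambda_gt0 R hq; rewrite /near ler_norml => /andP[h1 h2] h3.
have : b%:~R * l < (k + 1)%:~R * l by rewrite intrD; lra.
by rewrite ltr_pM2r // ltr_int ltzD1.
Qed.

Lemma near_opp x b : near (- x) (- b) <-> near x b.
Proof. by rewrite /near intrN mulNr -opprD normrN. Qed.

Lemma sub_shift x (b k : int) :
  x + k%:~R * l - (b + k)%:~R * l = x - b%:~R * l.
Proof. by rewrite intrD mulrDl opprD addrACA subrr addr0. Qed.

Lemma near_shift x b k : near (x + k%:~R * l) (b + k) <-> near x b.
Proof. by rewrite /near sub_shift. Qed.

Lemma sigmaN x : sigma (Some (- x)) = oppi (sigma (Some x)).
Proof. by rewrite /= oppr_eq0; case: eqP => //=; rewrite invrN. Qed.

Lemma oppiK : involutive oppi.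
Proof. by case=> //= x; rewrite opprK. Qed.

Lemma wlen_translate (k : int) n z : wlen n (translate (k%:~R * l) z) <-> wlen n z.
Proof.
have imp j v : wlen n v -> wlen n (translate (j%:~R * l) v).
  case: n => /= [-> //|n] [x [b [-> xb h]]].
  exists (x + j%:~R * l), (b + j); split; [by []|exact/near_shift|].
  by rewrite sub_shift.
split; last exact: imp.
by move=> /(imp (- k)); rewrite intrN mulNr translateK.
Qed.

Lemma wlen_opp n z : wlen n (oppi z) <-> wlen n z.
Proof.
have imp m v : wlen m v -> wlen m (oppi v).
  elim: m v => [_ -> //|m IH] _ [x [b [-> xb /IH h]]].
  exists (- x), (- b); split; [by []|exact/near_opp|].
  by rewrite intrN mulNr -opprD sigmaN.
by split=> [/imp|]; [rewrite oppiK | exact: imp].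
Qed.

(** A nonzero nearest coefficient occurs only at $x=\pm\lambda/2$; it leaves the remainder $-x$, and
    negation preserves length. *)
Lemma wlen_near n x : `|x| <= l / 2 ->
  wlen n.+1 (Some x) <-> wlen n (sigma (Some x)).
Proof.
have l0 := lambda_gt0 R hq; move=> hx; split; last first.
  by exists x, 0; split; rewrite /near ?mul0r ?subr0.
move=> [_ [b [[<-] xb h]]].
have [b0|bN0] := eqVneq b 0; first by move: h; rewrite b0 mul0r subr0.
have e : x - b%:~R * l = - x.
  move: xb hx; rewrite /near !ler_norml => /andP[h1 h2] /andP[h3 h4].
  have [b0|b0] := ltP b 0.
    have : b%:~R + 1 <= 0 :> R by rewrite -[1]/(1%:~R) -intrD lerz0 lezD1.
    by nra.
  have : 1 <= b%:~R :> R by rewrite ler1z -gtz0_ge1 lt_neqAle eq_sym bN0.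
  by nra.
by move: h; rewrite e sigmaN => /wlen_opp.
Qed.

Lemma wlen_step n x b : near x b ->
  wlen n.+1 (Some x) <-> wlen n (sigma (Some (x - b%:~R * l))).
Proof.
move=> xb; apply: iff_trans (wlen_near n xb).
by rewrite -[X in _ <-> X](wlen_translate b) /= subrK.
Qed.

(** By [wlen_step] the choice at a tie is immaterial, so [wlen] is the graph of a partial
    function. *)
Lemma wlen_inj n m z : wlen n z -> wlen m z -> n = m.
Proof.
elim: n m z => [|n IH] [|m] z //= => [-> [x [b []]] // | [x [b [-> _ _]]] // |].
move=> [x [b [-> xb h]]] /(wlen_step m xb) k.
by congr _.+1; apply: IH h k.
Qed.

(** * Lengths along a face and renormalisation *)

Lemma wlen_angleN n phi : wlen n (angle_pt (- phi)) <-> wlen n (angle_pt phi).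
Proof.
rewrite angle_ptN -[l]mul1r (wlen_translate 1); exact: wlen_opp.
Qed.

Lemma wlen_pi_sub n phi : wlen n (angle_pt (pi - phi)) <-> wlen n (angle_pt phi).
Proof. by rewrite addrC angle_ptDpi; exact: wlen_angleN. Qed.

Lemma wlen_sigma_angle n phi :
  wlen n (sigma (angle_pt phi)) <-> wlen n (angle_pt (phi - theta)).
Proof.
by rewrite angle_ptB -[l]mul1r (wlen_translate 1).
Qed.

(** The point lies in $[0,\lambda/2]$, so its coefficient may be taken to be 0, and [sigma] is one
    rotation of the face up to a translation. *)
Lemma wlen_angleB n phi : theta <= phi <= pi / 2 ->
  wlen n.+1 (angle_pt phi) <-> wlen n (angle_pt (phi - theta)).
Proof.
have th0 := theta_gt0; have th3 := mul3_theta_le_pi; move=> /andP[h1 h2].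
have hp : 0 < phi < pi by lra.
have x0 : 0 <= angle_val phi by rewrite -angle_val_theta ler_angle_val //; lra.
have x1 : angle_val phi <= l / 2 by rewrite -angle_val_pihalf ler_angle_val //; lra.
apply: iff_trans (wlen_sigma_angle n phi).
by rewrite angle_ptE //; apply: wlen_near; rewrite ger0_norm.
Qed.

Lemma wlen_angle_iter k n phi : k%:R * theta <= phi <= pi / 2 ->
  wlen n (angle_pt phi) <->
  exists2 a, n = (k + a)%N & wlen a (angle_pt (phi - k%:R * theta)).
Proof.
have th0 := theta_gt0; have th3 := mul3_theta_le_pi.
elim: k n phi => [|k IH] n phi /andP[h1 h2].
  by rewrite mul0r subr0; split=> [?|[a -> //]]; exists n.
have hk : 0 <= k%:R * theta by rewrite mulr_ge0 // ltW.
rewrite -natr1 mulrDl mul1r in h1 *.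
have -> : phi - (k%:R * theta + theta) = phi - theta - k%:R * theta by lra.
have hp : 0 < phi < pi by lra.
have step m : wlen m.+1 (angle_pt phi) <-> wlen m (angle_pt (phi - theta)).
  by apply: wlen_angleB; lra.
have {}IH m := IH m (phi - theta) ltac:(lra).
split=> [|[a -> ha]]; last by apply/step/IH; exists a.
case: n => [|n]; first by rewrite angle_ptE.
by move=> /step/IH[a -> ha]; exists a.
Qed.

Lemma wlen_sigma_pt n phi :
  wlen n (sigma (angle_pt phi)) <-> wlen n (angle_pt (theta - phi)).
Proof.
apply: iff_trans (wlen_sigma_angle n phi) _.
by rewrite -[theta - phi]opprB; apply: iff_sym; apply: wlen_angleN.
Qed.

Lemma angle_val_half_theta : angle_val (theta / 2) = -1.
Proof.
have th0 := theta_gt0; have th3 := mul3_theta_le_pi.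
rewrite /angle_val (_ : theta / 2 - theta = - (theta / 2)); last by lra.
by rewrite sinN mulNr divff // sin_neq0 //; lra.
Qed.

(** Brings the angles left over after going round the face back to the form of a pair [x],
    [sigma x]. The witness is minus the value at [chi], since [chi] and [theta - chi] are exchanged
    by [sigma] up to symmetries preserving length. *)
Lemma wlen_fold chi : theta / 2 <= chi <= theta ->
  exists2 x, 0 <= x <= 1 & forall n,
    (wlen n (angle_pt chi) <-> wlen n (Some x)) /\
    (wlen n (angle_pt (theta - chi)) <-> wlen n (sigma (Some x))).
Proof.
have th0 := theta_gt0; have th3 := mul3_theta_le_pi.
move=> /andP[h1 h2]; have hc : 0 < chi < pi by lra.
have ge : -1 <= angle_val chi by rewrite -angle_val_half_theta ler_angle_val //; lra.
have le : angle_val chi <= 0 by rewrite -angle_val_theta ler_angle_val //; lra.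
exists (- angle_val chi); first by lra.
move=> n; split; first by rewrite angle_ptE //; apply: iff_sym (wlen_opp n (Some _)).
apply: iff_trans (iff_sym (wlen_sigma_pt n chi)) _.
by rewrite angle_ptE // sigmaN; apply: iff_sym (wlen_opp _ _).
Qed.

(** Here $k=\lfloor q/2\rfloor-1$. It vanishes only for $q=3$, in the odd case. *)
Lemma odd_or_even : exists k,
  ((0 < k)%N /\ pi = 2 * (k%:R * theta) + 2 * theta :> R) \/
  pi = 2 * (k%:R * theta) + 3 * theta :> R.
Proof.
have [k qE] : exists k, (q = k.+1.*2 /\ (0 < k)%N) \/ q = k.+1.*2.+1.
  by exists q./2.-1; move: hq (odd_double_half q); case: (odd q) => /=; lia.
exists k; case: qE => [[qE k0]|qE]; [left; split=> // | right].
  by rewrite -[LHS]mulq_theta {1}qE -muln2 natrM -natr1; lra.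
by rewrite -[LHS]mulq_theta {1}qE -natr1 -muln2 natrM -natr1; lra.
Qed.

(* The face with vertices [angle_pt (k * theta)] lies over [x]: going round it
   in both directions from [x] and from [sigma x] reaches a smaller instance
   of the pair [x, sigma x], with the two roles exchanged when [q] is odd. *)
Lemma wlen_renorm x : l / 2 <= x <= 1 -> exists x' k, 0 <= x' <= 1 /\
  ([/\ (0 < k)%N,
     forall n, wlen n (Some x) <-> exists2 a, n = (k + a)%N & wlen a (Some x') &
     forall n, wlen n (sigma (Some x)) <->
       exists2 a, n = (k + a)%N & wlen a (sigma (Some x'))] \/
   (forall n, wlen n (Some x) <->
       exists2 a, n = (k.+1 + a)%N & wlen a (sigma (Some x'))) /\
   (forall n, wlen n (sigma (Some x)) <->
       exists2 a, n = (k + a)%N & wlen a (Some x'))).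
Proof.
have th0 := theta_gt0; have th3 := mul3_theta_le_pi.
move=> /andP[x1 x2].
have [phi hp xE] := angle_pt_surj x.
have {}x1 : pi / 2 <= phi.
  rewrite -ler_angle_val //; last by lra.
  by move: xE; rewrite angle_ptE // => -[->]; rewrite angle_val_pihalf.
have {}x2 : phi <= (pi + theta) / 2.
  rewrite -ler_angle_val //; last by lra.
  by move: xE; rewrite angle_ptE // => -[->]; rewrite angle_val_mid.
have [k kE] := odd_or_even.
have ex n m (w w' v : Rinf R) :
    (wlen n w <-> exists2 a, n = (m + a)%N & wlen a w') ->
    (forall a, wlen a w' <-> wlen a v) ->
    wlen n w <-> exists2 a, n = (m + a)%N & wlen a v.
  by move=> -> h; split=> -[a -> /h]; exists a.
rewrite -xE.
have xW n : wlen n (angle_pt phi) <-> wlen n (angle_pt (pi - phi)).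
  exact: iff_sym (wlen_pi_sub n phi).
case: kE => [[k0 piE]|piE].
  have [x' hx' W] := @wlen_fold (pi - phi - k%:R * theta) ltac:(lra).
  exists x', k; split=> //; left; split=> // n.
    apply: iff_trans (xW n) _.
    by apply: ex (wlen_angle_iter _ _) _; [lra | move=> a; case: (W a)].
  apply: iff_trans (wlen_sigma_angle n phi) _.
  apply: ex (@wlen_angle_iter k _ _ _) _; [lra | move=> a].
  (* The angles [pi - phi] and [phi - theta] add up to $(2k+1)\theta$, so after [k] steps on each
     side the remainders add up to $\theta$. *)
  have -> : phi - theta - k%:R * theta = theta - (pi - phi - k%:R * theta) by lra.
  by case: (W a).
(* Now the sum is $(2k+2)\theta$: the side of [x] takes one step more, and the remainder on the side
   of [sigma x] plays the role of [x']. *)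
have [x' hx' W] := @wlen_fold (phi - theta - k%:R * theta) ltac:(lra).
exists x', k; split=> //; right; split=> // n.
  apply: iff_trans (xW n) _.
  apply: ex (@wlen_angle_iter k.+1 _ _ _) _; [rewrite -natr1; lra | move=> a].
  rewrite -natr1.
  have -> : pi - phi - (k%:R + 1) * theta
              = theta - (phi - theta - k%:R * theta) by lra.
  by case: (W a).
apply: iff_trans (wlen_sigma_angle n phi) _.
by apply: ex (@wlen_angle_iter k _ _ _) _; [lra | move=> a; case: (W a)].
Qed.

(** * The effect of [sigma] on the length *)

(** Induction on the length. Renormalisation keeps the difference $d$ of the two lengths when $q$ is
    even and replaces it by $1-d$ when $q$ is odd; the set $\{0,1\}$ is stable under both. *)
Lemma wlen_sigma_unit n :
  (forall x, 0 <= x <= 1 -> wlen n (Some x) ->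
     exists2 m, wlen m (sigma (Some x)) & (m <= n <= m.+1)%N) /\
  (forall x, 0 <= x <= 1 -> wlen n (sigma (Some x)) ->
     exists2 m, wlen m (Some x) & (n <= m <= n.+1)%N).
Proof.
elim/ltn_ind: n => n IH.
have small x : 0 <= x <= l / 2 -> forall m,
    wlen m.+1 (Some x) <-> wlen m (sigma (Some x)).
  by move=> /andP[x0 x1] m; apply: wlen_near; rewrite ger0_norm.
have lo x : 0 <= x <= 1 -> wlen n (Some x) ->
    exists2 m, wlen m (sigma (Some x)) & (m <= n <= m.+1)%N.
  move=> /andP[x0 x1] W; have [xl|/ltW xl] := lerP x (l / 2).
    case: n IH W => [//|n] _ /small W; exists n; first by apply: W; rewrite x0.
    by lia.
  have [|x' [k [hx' [[k0 Wx Ws]|[Wx Ws]]]]] := @wlen_renorm x; first by rewrite xl.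
    have [a nE /(proj1 (IH a ltac:(lia)) _ hx')[m Wm hm]] := (Wx n).1 W.
    by exists (k + m)%N; [apply/Ws; exists m | lia].
  have [a nE /(proj2 (IH a ltac:(lia)) _ hx')[m Wm hm]] := (Wx n).1 W.
  by exists (k + m)%N; [apply/Ws; exists m | lia].
split=> // x /andP[x0 x1] W; have [xl|/ltW xl] := lerP x (l / 2).
  by exists n.+1; [apply/small; rewrite ?x0 | lia].
have [|x' [k [hx' [[k0 Wx Ws]|[Wx Ws]]]]] := @wlen_renorm x; first by rewrite xl.
  have [a nE /(proj2 (IH a ltac:(lia)) _ hx')[m Wm hm]] := (Ws n).1 W.
  by exists (k + m)%N; [apply/Wx; exists m | lia].
have [a nE Wa] := (Ws n).1 W.
have [m Wm hm] : exists2 m, wlen m (sigma (Some x')) & (m <= a <= m.+1)%N.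
  (* For [k = 0] the length does not drop, so the first half, already proved for this [n], replaces
     the induction hypothesis. *)
  case: (posnP k) nE => [-> nE|k0 nE].
    by rewrite add0n in nE; rewrite -nE in Wa *; apply: lo.
  by apply: (proj1 (IH a ltac:(lia)) _ hx').
by exists (k.+1 + m)%N; [apply/Wx; exists m | lia].
Qed.

(** For $x>1$ the bounds are applied to $x^{-1}$, where [sigma] exchanges the two points up to
    sign. *)
Lemma wlen_sigma n z : wlen n z -> exists2 m, wlen m (sigma z) & (m <= n.+1)%N.
Proof.
have pos x : 0 <= x -> wlen n (Some x) ->
    exists2 m, wlen m (sigma (Some x)) & (m <= n.+1)%N.
  move=> x0 W; have [x1|x1] := lerP x 1.
    have [|m Wm hm] := proj1 (wlen_sigma_unit n) x _ W; first by rewrite x0.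
    by exists m => //; lia.
  have xN0 : x != 0 by rewrite gt_eqF // (lt_trans ltr01).
  have sE : sigma (Some x) = oppi (Some x^-1) by rewrite /= (negbTE xN0).
  have sK : sigma (Some x^-1) = oppi (Some x) by rewrite /= invr_eq0 (negbTE xN0) invrK.
  have [||m Wm hm] := proj2 (wlen_sigma_unit n) x^-1 _ _.
  - by rewrite invr_ge0 x0 invf_le1 ?(lt_trans ltr01) // ltW.
  - by rewrite sK; apply/wlen_opp.
  by exists m; [rewrite sE; apply/wlen_opp | lia].
case: z => [x|]; last first.
  case: n {pos} => [_|n [x [b []]] //]; exists 1%N => //.
  have l0 := lambda_gt0 R hq.
  by apply/wlen_near; rewrite /= ?eqxx // normr0 divr_ge0 // ltW.
have [|x0] := lerP 0 x; first exact: pos.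
move=> /wlen_opp/pos[|m]; first by rewrite oppr_ge0 ltW.
by rewrite sigmaN => /wlen_opp; exists m.
Qed.

(** Each term is [sigma] followed by a translation, so it raises the length by at most 1. *)
Lemma wlen_rosen_value t :
  exists2 m, wlen m (rosen_value R q t) & (m <= size t)%N.
Proof.
elim: t => [|b t [m /wlen_sigma[m' W h1] h2]]; first by exists 0%N.
by exists m'; [apply/wlen_translate | apply: leq_trans h1 _].
Qed.

(** * Comparing a point with the value of a prefix of its expansion *)

(* [u] is the value of [s], and [w] has an expansion beginning with [s], where
   in both cases every coefficient is a nearest one. *)
Fixpoint common s u w : Prop :=
  if s is b :: s' then
    exists x y, [/\ u = Some x /\ w = Some y, near x b, near y b
      & common s' (sigma (Some (x - b%:~R * l))) (sigma (Some (y - b%:~R * l)))]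
  else u = None.

Lemma common_shift k b s x y : common (b :: s) (Some x) (Some y) ->
  common (b + k :: s) (Some (x + k%:~R * l)) (Some (y + k%:~R * l)).
Proof.
move=> [_ [_ [[[<-] [<-]] xb yb h]]].
exists (x + k%:~R * l), (y + k%:~R * l); split=> //; try exact/near_shift.
by rewrite !sub_shift.
Qed.

Lemma common_opp s u w : common s u w -> common (map -%R s) (oppi u) (oppi w).
Proof.
elim: s u w => [_ w -> //|b s IH] _ _ [x [y [[-> ->] xb yb /IH h]]].
exists (- x), (- y); split=> //; try exact/near_opp.
by rewrite intrN mulNr -!opprD !sigmaN.
Qed.

Lemma wlen_common s u w : common s u w -> wlen (size s) u.
Proof.
elim: s u w => // b s IH _ _ [x [y [[-> _] xb _ /IH h]]].
by exists x, b.
Qed.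

Lemma common_gt s x w : common s (Some x) w -> l / 2 < x ->
  exists2 y, w = Some y & 0 < y.
Proof.
have l0 := lambda_gt0 R hq; case: s => // b s [_ [y [[[<-] ->] xb yb _]]] hx.
exists y => //; have := near_ge1 xb hx; rewrite -(ler_int R).
by move: yb; rewrite /near ler_norml => /andP[h1 h2] b1; nra.
Qed.

Lemma common_ge s x y : common s (Some x) (Some y) -> l / 2 < y -> l / 2 <= x.
Proof.
have l0 := lambda_gt0 R hq; case: s => // b s [_ [_ [[[<-] [<-]] xb yb _]]] hy.
have := near_ge1 yb hy; rewrite -(ler_int R).
by move: xb; rewrite /near ler_norml => /andP[h1 h2] b1; nra.
Qed.

Lemma angle_ptD phi : angle_pt (phi + theta) = sigma (translate (- l) (angle_pt phi)).
Proof. by rewrite -[in RHS](addrK theta phi) angle_ptB translateK sigmaK. Qed.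

(** The shared coefficient is 1: the bound on [psi] makes it at least 1, the upper bound on [phi] at
    most 1. Removing it rotates both angles by [theta]. *)
Lemma common_step s phi psi : common s (angle_pt phi) (angle_pt psi) ->
  pi / 2 <= phi <= pi - theta -> pi / 2 < psi < pi ->
  exists s', common s' (angle_pt (phi + theta)) (angle_pt (psi + theta)).
Proof.
have th0 := theta_gt0; have th3 := mul3_theta_le_pi; have l0 := lambda_gt0 R hq.
move=> h /andP[p1 p2] /andP[q1 q2].
have hp : 0 < phi < pi by lra.
have hq' : 0 < psi < pi by lra.
move: h; rewrite !angle_ptD !angle_ptE //; case: s => // b s.
move=> [_ [_ [[[<-] [<-]] xb yb h]]]; exists s.
suff -> : l = b%:~R * l by [].
have -> : b = 1; last by rewrite mul1r.
apply/eqP; rewrite eq_le (near_le xb) ?(near_ge1 yb) //.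
  by rewrite -angle_val_pihalf ltr_angle_val //; lra.
rewrite mul1r; have : angle_val phi <= l by rewrite -angle_valBpi ler_angle_val //; lra.
by lra.
Qed.

(** While the first angle stays between $\pi/2$ and $\pi$, [common_gt] makes the second value
    positive; had the second angle reached $\pi$, its point would be infinite or at most 0. *)
Lemma common_iter k s phi psi : common s (angle_pt phi) (angle_pt psi) ->
  pi / 2 <= phi -> phi + k%:R * theta < pi -> pi / 2 < psi < pi ->
  psi + k%:R * theta < pi /\
  exists s', common s' (angle_pt (phi + k%:R * theta)) (angle_pt (psi + k%:R * theta)).
Proof.
have th0 := theta_gt0; have th3 := mul3_theta_le_pi.
move=> h p1 + /andP[q1 q2]; elim: k => [|k IH].
  by rewrite !mul0r !addr0; split=> //; exists s.
have hk : 0 <= k%:R * theta by rewrite mulr_ge0 // ltW.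
rewrite -natr1 mulrDl mul1r !addrA => pk.
have [|qk [s' hs']] := IH; first by lra.
have [| |t ht] := common_step hs'; [lra | lra |].
split; last by exists t.
move: (ht); rewrite [angle_pt (phi + _ + _)]angle_ptE; last by lra.
move=> /common_gt[|y yE y0].
  by rewrite -angle_val_pihalf ltr_angle_val //; lra.
rewrite ltNge; apply/negP => qk1; move: yE; rewrite -angle_ptBpi.
have [->|a0] := eqVneq (psi + k%:R * theta + theta - pi) 0; first by rewrite angle_pt0.
have {}a0 : 0 < psi + k%:R * theta + theta - pi by rewrite lt_neqAle eq_sym a0; lra.
rewrite angle_ptE; last by lra.
move=> [yE]; move: y0; apply/negP; rewrite -leNgt -yE -angle_val_theta.
by rewrite ler_angle_val //; lra.
Qed.

Lemma angle_val_top : angle_val (pi - theta / 2) = 1 + l.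
Proof.
have th0 := theta_gt0; have th3 := mul3_theta_le_pi.
have s0 : sin (theta / 2) != 0 by apply: sin_neq0; lra.
rewrite /angle_val -addrA -opprD !sin_pi_sub /lambda.
have -> : cos theta = 1 - 2 * sin (theta / 2) ^+ 2.
  rewrite [in LHS](_ : theta = (theta / 2) *+ 2); last by rewrite -mulr_natr; lra.
  rewrite cos_mulr2n cos2sin2; lra.
have -> : theta / 2 + theta = (theta / 2) *+ 2 + theta / 2.
  by rewrite -mulr_natr; lra.
rewrite sinD sin_mulr2n cos_mulr2n.
have := cos2sin2 (theta / 2); move: (cos _) (sin _) s0 => c s s0 c2.
apply: (mulIf s0); rewrite divfK //.
by ring: c2.
Qed.

(** The angle of 1 reaches $\pi$ after exactly $k+1$ steps, so [psi] would reach $\pi$ while [phi]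
    would not, against [common_iter]. *)
Lemma common_one_odd k s x y : pi = 2 * (k%:R * theta) + 3 * theta :> R ->
  common s (Some x) (Some y) -> x < 1 -> 1 <= y -> False.
Proof.
have th0 := theta_gt0; have th3 := mul3_theta_le_pi; have l2 := lambda_lt2.
move=> piE h x1 y1.
have xl : l / 2 <= x by apply: common_ge h _; lra.
move: h; have [phi hp xE] := angle_pt_surj x; have [psi hs yE] := angle_pt_surj y.
rewrite -xE -yE => h.
move: xE yE; rewrite !angle_ptE // => -[xE] -[yE].
rewrite -{}xE in x1 xl; rewrite -{}yE in y1.
rewrite -angle_val_pihalf ler_angle_val // in xl; last by lra.
rewrite -angle_val_mid ltr_angle_val // in x1; last by lra.
rewrite -angle_val_mid ler_angle_val // in y1; last by lra.
have kE : k.+1%:R * theta = k%:R * theta + theta by rewrite -natr1; lra.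
by have [] := @common_iter k.+1 _ _ _ h xl ltac:(lra) ltac:(lra); lra.
Qed.

(** The angle $\pi/2+\theta$ of [2 / l] moves in $k$ steps to $\pi$ if $q$ is even, which
    contradicts [common_iter]. If $q$ is odd it moves to $\pi-\theta/2$, the angle of $1+\lambda$;
    subtracting $\lambda$ leads to [common_one_odd]. *)
Lemma common_bound s x y :
  common s (Some x) (Some y) -> 2 / l <= y -> 2 / l <= x.
Proof.
have th0 := theta_gt0; have th3 := mul3_theta_le_pi; have l2 := lambda_lt2.
have l0 := lambda_gt0 R hq.
have ll : l / 2 < 2 / l by rewrite ltr_pdivlMr //; nra.
move=> h yl; rewrite leNgt; apply/negP => x2.
have xl : l / 2 <= x by apply: common_ge h _; lra.
move: h; have [phi hp xE] := angle_pt_surj x; have [psi hs yE] := angle_pt_surj y.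
rewrite -xE -yE => h.
move: xE yE; rewrite !angle_ptE // => -[xE] -[yE].
rewrite -{}xE in x2 xl; rewrite -{}yE in yl.
rewrite -angle_val_pihalf ler_angle_val // in xl; last by lra.
rewrite -angle_val_pihalfD ltr_angle_val // in x2; last by lra.
rewrite -angle_val_pihalfD ler_angle_val // in yl; last by lra.
have [k [[k0 piE]|piE]] := odd_or_even.
  by have [] := @common_iter k _ _ _ h xl ltac:(lra) ltac:(lra); lra.
have hk : 0 <= k%:R * theta by rewrite mulr_ge0 // ltW.
have [qk [s']] := @common_iter k _ _ _ h xl ltac:(lra) ltac:(lra).
rewrite !angle_ptE; try lra.
case: s' => // b s' /(@common_shift (-1)) /(common_one_odd piE); apply.
  by rewrite mulN1r ltrBlDr -angle_val_top ltr_angle_val //; lra.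
by rewrite mulN1r lerBrDr -angle_val_top ler_angle_val //; lra.
Qed.

Lemma common_norm_bound s x y :
  common s (Some x) (Some y) -> 2 / l <= `|y| -> 2 / l <= `|x|.
Proof.
move=> h; case: ger0P => [y0 yl|y0 yl].
  exact: le_trans (common_bound h yl) (ler_norm x).
rewrite -normrN; apply: le_trans (ler_norm _).
exact: common_bound (common_opp h) yl.
Qed.

(** * Prefixes of the output are geodesic *)

Fixpoint near_digits s w : Prop :=
  if s is b :: s' then
    exists x, [/\ w = Some x, near x b & near_digits s' (sigma (Some (x - b%:~R * l)))]
  else True.

Lemma common_rosen_value s w : near_digits s w -> common s (rosen_value R q s) w.
Proof.
have l0 := lambda_gt0 R hq.
elim: s w => //= b s IH _ [y [-> yb /IH]]; rewrite /rosen_s.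
case: s {IH} => [_|c s].
  exists (0 + b%:~R * l), y; split=> //; first by rewrite /near add0r subrr normr0; lra.
  by rewrite /= addrK eqxx.
move: (rosen_value _ _ _) => z h.
have [x [y1 [[zE wE] _ _ _]]] := h; rewrite {}zE in h *.
move: wE h; case: eqP => // /eqP e0 _ h.
(* The remainder [y - b * l] has modulus at most [l / 2], so its image under [sigma] has modulus at
   least [2 / l]. This passes to the value [x] of the tail, and then [b] is nearest for the prefix
   as well. *)
have x2 : 2 / l <= `|x|.
  apply: common_norm_bound h _; rewrite normrN normfV.
  by rewrite -[2 / l]invf_div lef_pV2 ?posrE ?normr_gt0 // divr_gt0.
have xN0 : x != 0.
  by apply: contraTneq x2 => ->; rewrite normr0 -ltNge divr_gt0.
rewrite /= (negbTE xN0).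
exists (- x^-1 + b%:~R * l), y; split=> //.
  rewrite /near addrK normrN normfV -[l / 2]invf_div.
  by rewrite lef_pV2 ?posrE ?normr_gt0 // divr_gt0.
by rewrite addrK /= oppr_eq0 invr_eq0 (negbTE xN0) (negbTE e0) invrN invrK opprK.
Qed.

Lemma near_digits_ni y k m :
  (forall j, (k <= j < k + m)%N -> ni_rem q y j <> None) ->
  near_digits (map (ni_coef q y) (iota k m)) (ni_rem q y k).
Proof.
elim: m k => //= m IH k fin.
have := fin k; have := IH k.+1; rewrite /ni_coef /=.
case: (ni_rem q y k) => [x|]; last by move=> _ /(_ ltac:(lia)).
move=> h _; exists x; split=> //; first exact: near_nearest.
by apply: h => j hj; apply: fin; lia.
Qed.

(** The value of the prefix has length exactly [m], and no expansion is shorter than the length of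
    its value. *)
Lemma geodesic_ni_prefix y m : (0 < m)%N ->
  (forall j, (j < m)%N -> ni_rem q y j <> None) ->
  geodesic_finite R q (mkseq (ni_coef q y) m).
Proof.
move=> m0 fin; split=> [|t _ tE]; first by rewrite size_mkseq.
have [n Wn hn] := wlen_rosen_value t.
have h : near_digits (mkseq (ni_coef q y) m) (Some y) by exact: (@near_digits_ni y 0).
have := wlen_common (common_rosen_value h); rewrite -tE.
by move=> /(wlen_inj Wn) <-.
Qed.

(** * Termination and Farey vertices *)

Lemma ni_rem_stops n y k : wlen n (ni_rem q y k) -> exists j, ni_rem q y j = None.
Proof.
elim: n k => [|n IH] k; first by exists k.
case E: (ni_rem q y k) => [x|]; last by exists k.
by move=> /(wlen_step n (near_nearest x)) W; apply: (IH k.+1); rewrite /= E.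
Qed.

(** Infinity has length 0, so this invariance gives every vertex a finite length. *)
Lemma in_G_wlen g : in_G q g ->
  forall z, (exists n, wlen n z) <-> (exists n, wlen n (g z)).
Proof.
have sig v : (exists n, wlen n v) -> exists n, wlen n (sigma v).
  by move=> [n /wlen_sigma[m]]; exists m.
elim=> [z //|z|z|f h _ IHf _ IHh z|f h _ IHf fK hK z].
- by split=> /sig //; rewrite sigmaK.
- rewrite /tau -[l]mul1r.
  by split=> -[n /(wlen_translate 1) ?]; exists n => //; apply/(wlen_translate 1).
- by apply: iff_trans (IHh z) (IHf _).
- by rewrite -{1}(hK z); apply: iff_sym (IHf _).
Qed.

Lemma farey_vertex_rosen_s b z : farey_vertex q z -> farey_vertex q (rosen_s q b z).
Proof.
move=> [g Gg ->]; have : farey_vertex q (sigma (g None)).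
  by exists (sigma \o g) => //; apply: in_G_comp; [exact: in_G_sigma|].
rewrite /rosen_s; move: (sigma _) => v {g Gg}.
elim/int_ind: b => [|n IH|n IH] V.
- by rewrite mul0r; case: v V => [x|] //=; rewrite addr0.
- have [h Gh hE] := IH V; exists (@tau R q \o h); first exact/in_G_comp/Gh/in_G_tau.
  rewrite /= -hE /tau; case: (v) => //= x.
  by congr Some; rewrite intS intrD; ring.
- have [h Gh hE] := IH V; exists (translate (- l) \o h).
    apply: in_G_comp Gh; apply: in_G_inv (in_G_tau R q) _ _; first exact: translateK.
    by move=> w; rewrite /tau -[X in translate X (translate _ _)]opprK translateK.
  by rewrite /= -hE; case: (v) => //= x; congr Some; rewrite intS !intrN intrD; ring.
Qed.

(** Each remainder is the image of the next under some [rosen_s], which leads from infinity back to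
    [y]. *)
Lemma farey_vertex_ni_stops y n : ni_rem q y n = None -> farey_vertex q (Some y).
Proof.
move=> h; have : farey_vertex q (ni_rem q y n).
  by rewrite h; exists id => //; exact: in_G_id.
elim: n {h} => //= n IH; case E: (ni_rem q y n) IH => [x|] IH; last exact: IH.
by move=> /(farey_vertex_rosen_s (nearest q x)); rewrite rosen_s_invK => /IH.
Qed.

End Rosen.

Theorem theorem1 (R : realType) (q : nat) (y : R) (hq : (3 <= q)%N) :
  geodesic R q (nearest_integer_cf q y) /\
  (is_finite_cf (nearest_integer_cf q y) <-> farey_vertex q (Some y)).
Proof.
rewrite /nearest_integer_cf; case: pselect => [stops|go] /=.
  case: ex_minnP => n /eqP stop nmin; split; last first.
    by split=> // _; apply: farey_vertex_ni_stops stop.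
  apply: (geodesic_ni_prefix hq) => [|j jn /eqP/nmin]; last by rewrite leqNgt jn.
  (* The stopping index is positive because the remainder of index 0 is [y] itself. *)
  by case: n stop {nmin}.
split=> [m m0|].
  by apply: geodesic_ni_prefix => // j _ h; apply: go; exists j; rewrite h.
split=> // -[g Gg yE]; apply: go.
have [n W] : exists n, wlen q n (Some y).
  by rewrite yE; apply: (in_G_wlen hq Gg None).1; exists 0%N.
have [j h] := @ni_rem_stops R q hq n y 0%N W.
by exists j; rewrite h.
Qed.
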